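(* A data-independent completable queue implementation has no $\mathsf{VRepet}$ violations if and only if for every value $v$, every $m>1$ and every $k\in\mathbb{N}$, the program $$\mathit{Prg}(v,1,m,k)=\big(\mathtt{enq}(v)\ \|\ \underbrace{\mathtt{deq}(v)\,\|\,\cdots\,\|\,\mathtt{deq}(v)}_{m}\ \|\ \underbrace{C\,\|\,\cdots\,\|\,C}_{k}\big),\qquad C=\bigsqcup_{x\neq v}\mathtt{enq}(x)\ \sqcup\ \bigsqcup_{x\neq v}\mathtt{deq}(x),$$ has no execution in which more than one $\mathtt{deq}(v)$ thread terminates.
   Context: A queue implementation provides methods $\mathtt{enq}(x)$ and $\mathtt{deq}()$ acting on shared state; its executions are interleavings of atomic steps of threads, each inducing a history of invocation and response actions. A completion of a history $c$ is a complete history obtained from $c\cdot c'$, with $c'$ consisting only of response actions, by deleting the actions of still-pending events; the implementation is completable if for each induced history $c$ some completion of $c$ is itself an induced history. For a value $v$, $\mathtt{deq}(v)$ is the dequeue method instrumented to behave exactly as $\mathtt{deq}()$ except that it diverges whenever $\mathtt{deq}()$ would return a value other than $v$. $\sqcup$ is nondeterministic choice and $\|$ is parallel composition of threads (each running once) over one shared instance of the implementation in its initial state. A history is differentiated if the input arguments of all its invocations are pairwise distinct; for $f$ a function on data values, $f(c)$ applies $f$ to all data values in history $c$. The implementation, with set of histories $H$, is data independent if (1) $f(c)\in H$ for every $c\in H$ and every $f$, and (2) for every $c\in H$ there is a differentiated $c'\in H$ and an $f$ with $c=f(c')$. The implementation has a $\mathsf{VRepet}$ violation if some induced history contains, for some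 value $v\neq\mathtt{NULL}$, more completed dequeue events returning $v$ than enqueue events of $v$.
   Formalization: A VRepet violation is additionally required to contain at least two completed dequeues of v; otherwise an implementation in which just one dequeue returns an arbitrary never-enqueued value would refute the ''if'' direction. *)

(* Defs.v *)
From mathcomp Require Import all_boot.

Set Implicit Arguments.
Unset Strict Implicit.
Unset Printing Implicit Defensive.

(* Data values form an eqType [V].  A dequeue returns an [option V]; [None] is
   NULL, which is therefore not a data value: it cannot be enqueued and is fixed
   by every renaming of data values. *)

(* Histories: finite sequences of invocations and responses, tagged with the
   thread that performs them.  A dequeue has no input argument; its value is
   carried by its response. *)

Inductive action (V : Type) : Type :=
| InvEnq of V
| InvDeq
| RetEnq
| RetDeq of option V.
Arguments InvDeq {V}.
Arguments RetEnq {V}.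

Definition history (V : Type) : Type := seq (nat * action V).

Section Histories.
Variable V : eqType.
Implicit Types (a b : action V) (h c d : history V) (t : nat) (v : V).

Definition is_inv a : bool :=
  match a with InvEnq _ | InvDeq => true | _ => false end.

Definition is_ret a : bool := ~~ is_inv a.

Definition matching a b : bool :=
  match a, b with
  | InvEnq _, RetEnq => true
  | InvDeq, RetDeq _ => true
  | _, _ => false
  end.

Definition thread_actions t h : seq (action V) :=
  [seq e.2 | e <- h & e.1 == t].

Fixpoint alternating (s : seq (action V)) : bool :=
  match s with
  | [::] => true
  | [:: a] => is_inv a
  | a :: b :: s' => matching a b && alternating s'
  end.

Definition well_formed h : Prop := forall t, alternating (thread_actions t h).

Definition has_pending t h : bool :=
  if thread_actions t h is a :: s then is_inv (last a s) else false.

Definition complete h : Prop := well_formed h /\ forall t, ~~ has_pending t h.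

(* In a well-formed history an invocation is pending exactly when its thread
   performs no later action. *)
Fixpoint delete_pending h : history V :=
  if h is e :: h' then
    if is_inv e.2 && ~~ has (fun e' => e'.1 == e.1) h'
    then delete_pending h' else e :: delete_pending h'
  else [::].

Definition completion c d : Prop :=
  complete d /\
  exists c', [/\ all (fun e => is_ret e.2) c', well_formed (c ++ c')
               & d = delete_pending (c ++ c')].

Definition inputs h : seq V :=
  pmap (fun e => if e.2 is InvEnq x then Some x else None) h.

Definition differentiated h : Prop := uniq (inputs h).

Definition rename_action (f : V -> V) a : action V :=
  match a with
  | InvEnq x => InvEnq (f x)
  | InvDeq => InvDeq
  | RetEnq => RetEnq
  | RetDeq o => RetDeq (omap f o)
  end.

Definition rename (f : V -> V) h : history V :=
  [seq (e.1, rename_action f e.2) | e <- h].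

(* Enqueue events are counted whether or not they are pending, dequeue events
   only when completed. *)
Definition enq_count v h : nat :=
  count (fun e => if e.2 is InvEnq x then x == v else false) h.

Definition deq_count v h : nat :=
  count (fun e => if e.2 is RetDeq o then o == Some v else false) h.

End Histories.

(* The code of a method: control points [pc] (local state included), atomic steps
   on the shared state [S], and the values that may be returned at a control
   point.  The code has no access to the identity of the calling thread. *)
Record method (S A R : Type) : Type := Method {
  pc : Type;
  start : A -> pc;
  astep : S -> pc -> S -> pc -> Prop;
  returns : pc -> R -> Prop
}.

Record queue_impl (V : Type) : Type := QueueImpl {
  shared : Type;
  init : shared;
  enq : method shared V unit;
  deq : method shared unit (option V)
}.

Definition update (T : Type) (p : nat -> T) (t : nat) (s : T) : nat -> T :=
  fun u => if u == t then s else p u.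

(* Executions of the implementation: unboundedly many threads, each of which
   calls arbitrary methods, one after the other, any number of times. *)
Section Executions.
Variables (V : eqType) (I : queue_impl V).

Inductive client : Type :=
| Idle
| InEnq of pc (enq I)
| InDeq of pc (deq I).

Definition config : Type := (shared I * (nat -> client))%type.

Inductive exec : history V -> config -> Prop :=
| exec_init : exec [::] (init I, fun=> Idle)
| exec_inv_enq h s p t x : exec h (s, p) -> p t = Idle ->
    exec (rcons h (t, InvEnq x)) (s, update p t (InEnq (start (enq I) x)))
| exec_inv_deq h s p t : exec h (s, p) -> p t = Idle ->
    exec (rcons h (t, InvDeq)) (s, update p t (InDeq (start (deq I) tt)))
| exec_enq h s p t q s' q' : exec h (s, p) -> p t = InEnq q ->
    astep s q s' q' -> exec h (s', update p t (InEnq q'))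
| exec_deq h s p t q s' q' : exec h (s, p) -> p t = InDeq q ->
    astep s q s' q' -> exec h (s', update p t (InDeq q'))
| exec_ret_enq h s p t q : exec h (s, p) -> p t = InEnq q ->
    returns q tt -> exec (rcons h (t, RetEnq)) (s, update p t Idle)
| exec_ret_deq h s p t q o : exec h (s, p) -> p t = InDeq q ->
    returns q o -> exec (rcons h (t, RetDeq o)) (s, update p t Idle).

Definition induced (h : history V) : Prop := exists g, exec h g.

Definition completable : Prop :=
  forall c, induced c -> exists2 d, completion c d & induced d.

Definition data_independent : Prop :=
  (forall f c, induced c -> induced (rename f c)) /\
  (forall c, induced c ->
     exists c' f, [/\ induced c', differentiated c' & c = rename f c']).

(* The number of completed dequeues of [v] exceeds the number of enqueues of [v],
   and there are at least two of them.  The conjunct [1 < deq_count v h] only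
   discards the case of a value dequeued once and never enqueued, in which
   nothing is repeated.  An implementation in which one dequeue succeeds and
   returns an arbitrary value shows that this case cannot be detected by
   programs observing two dequeues of the same value. *)
Definition VRepet_violation : Prop :=
  exists h v, [/\ induced h, 1 < deq_count v h & enq_count v h < deq_count v h].

End Executions.

(* Programs.  [Deq o] is the dequeue method instrumented to return only [o]. *)
Inductive cmd (V : Type) : Type :=
| Enq of V
| Deq of option V
| Choose (A : Type) of (A -> cmd V).
Arguments Choose {V} A _.

Definition orc (V : Type) (c1 c2 : cmd V) : cmd V :=
  Choose bool (fun b => if b then c1 else c2).

(* The parallel composition of the listed threads. *)
Definition program (V : Type) : Type := seq (cmd V).

(* In the second choice [o] ranges over NULL as well. *)
Definition other (V : eqType) (v : V) : cmd V :=
  orc (Choose {x : V | x != v} (fun x => Enq (val x)))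
      (Choose {o : option V | o != Some v} (fun o => Deq (val o))).

Definition Prg (V : eqType) (v : V) (n m k : nat) : program V :=
  nseq n (Enq v) ++ nseq m (Deq (Some v)) ++ nseq k (other v).

Section ProgramExecutions.
Variables (V : eqType) (I : queue_impl V).

Inductive thread : Type :=
| Todo of cmd V
| RunEnq of pc (enq I)
| RunDeq of option V & pc (deq I)
| Diverged
| Terminated.

Inductive thread_step (s : shared I) : thread -> shared I -> thread -> Prop :=
| step_choice A (b : A -> cmd V) i :
    thread_step s (Todo (Choose A b)) s (Todo (b i))
| step_call_enq x :
    thread_step s (Todo (Enq x)) s (RunEnq (start (enq I) x))
| step_call_deq o :
    thread_step s (Todo (Deq o)) s (RunDeq o (start (deq I) tt))
| step_enq q s' q' : astep s q s' q' ->
    thread_step s (RunEnq q) s' (RunEnq q')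
| step_deq o q s' q' : astep s q s' q' ->
    thread_step s (RunDeq o q) s' (RunDeq o q')
| step_ret_enq q : returns q tt ->
    thread_step s (RunEnq q) s Terminated
| step_ret_deq o q : returns q o ->
    thread_step s (RunDeq o q) s Terminated
| step_bad_deq o q o' : returns q o' -> o' <> o ->
    thread_step s (RunDeq o q) s Diverged
| step_diverge :
    thread_step s Diverged s Diverged.

(* [prg_exec P s ts]: some execution of [P] on a fresh instance of the
   implementation leads to the shared state [s] and the thread states [ts]. *)
Inductive prg_exec (P : program V) : shared I -> seq thread -> Prop :=
| prg_init : prg_exec P (init I) (map Todo P)
| prg_step s s' ts1 th th' ts2 :
    prg_exec P s (ts1 ++ th :: ts2) -> thread_step s th s' th' ->
    prg_exec P s' (ts1 ++ th' :: ts2).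

Definition terminated (th : thread) : bool :=
  if th is Terminated then true else false.

(* The [deq(v)] threads of [Prg v n m k] are those at positions
   n, ..., n + m - 1. *)
Definition deq_terminated (n m : nat) (ts : seq thread) : nat :=
  count terminated (take m (drop n ts)).

End ProgramExecutions.

(* Main.v *)
Require Import Defs.
From mathcomp Require Import all_boot.

(** A program execution is an execution of the implementation in which thread [i]
    of the program is thread [i] of the history; the only enqueue of [v] in it is
    that of thread 0, so two terminated [deq(v)] threads give a violation.

    Conversely, rename a differentiated history so that one value is dequeued at
    least twice and enqueued at most once, and give every event of this history
    to a program thread of its own.  Which thread performs a dequeue depends on
    the value it eventually returns, so the threads are assigned only at the end. *)

Set Implicit Arguments.
Unset Strict Implicit.
Unset Printing Implicit Defensive.

(** * Inputs and outputs of histories *)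

Section Histories.
Variable V : eqType.
Implicit Types (h : history V) (v x : V) (t : nat).

Definition outputs h : seq V :=
  pmap (fun e => if e.2 is RetDeq o then o else None) h.

Lemma enq_countE v h : enq_count v h = count_mem v (inputs h).
Proof. by elim: h => [|[t [x||| o]] h IH] //=; rewrite IH. Qed.

Lemma deq_countE v h : deq_count v h = count_mem v (outputs h).
Proof. by elim: h => [|[t [x|||[x|]]] h IH] //=; rewrite IH. Qed.

Lemma inputs_rename f h : inputs (rename f h) = map f (inputs h).
Proof. by elim: h => [|[t [x||| o]] h IH] //=; rewrite IH. Qed.

Lemma outputs_rename f h : outputs (rename f h) = map f (outputs h).
Proof. by elim: h => [|[t [x|||[x|]]] h IH] //=; rewrite IH. Qed.

Lemma enq_count_rcons v h e : enq_count v (rcons h e) =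
  enq_count v h + nat_of_bool (if e.2 is InvEnq x then x == v else false).
Proof. by rewrite /enq_count -cats1 count_cat /= addn0. Qed.

Lemma deq_count_rcons v h e : deq_count v (rcons h e) =
  deq_count v h + nat_of_bool (if e.2 is RetDeq o then o == Some v else false).
Proof. by rewrite /deq_count -cats1 count_cat /= addn0. Qed.

End Histories.

(** * Reduction to a value that is enqueued at most once *)

Lemma count_mem_gt1 (T : eqType) (s : seq T) :
  ~~ uniq s -> exists x, 1 < count_mem x s.
Proof.
elim: s => //= x s IH; rewrite negb_and negbK => /orP[xs|/IH[y y2]].
  by exists x; rewrite eqxx add1n ltnS -has_count has_pred1.
by exists y; apply: leq_trans y2 (leq_addl _ _).
Qed.

(* If no output is repeated, some output [w] was never an input, and merging it
   into another output keeps the number of inputs. *)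
Lemma VRepet_violation_differentiated (V : eqType) (I : queue_impl V) :
  data_independent I -> VRepet_violation I ->
  exists h v, [/\ induced I h, 1 < deq_count v h & enq_count v h <= 1].
Proof.
move=> [dren ddiff] [h0 [v [/ddiff[h [f [ih uh ->]]]]]].
rewrite deq_countE enq_countE inputs_rename outputs_rename !count_map.
rewrite -!size_filter.
(* [D] and [E] list the outputs and inputs of [h] that [f] sends to [v]. *)
set D := filter _ _; set E := filter _ _ => D1 ED.
have [uD|/count_mem_gt1[w w2]] := boolP (uniq D); last first.
  exists h, w; split=> //; last by rewrite enq_countE count_uniq_mem ?leq_b1.
  rewrite deq_countE; apply: leq_trans w2 _.
  by rewrite count_filter; apply: sub_count => x /= /andP[].
(* Pigeonhole: [D] has no duplicates and is longer than [E]. *)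
have [w wD wE] : exists2 w, w \in D & w \notin E.
  apply/hasP; apply/negPn; rewrite -all_predC; apply/negP => /allP DE.
  move: ED; rewrite ltnNge uniq_leq_size // => x /DE /=; by rewrite negbK.
have [u uDr] : exists u, u \in rem w D.
  case: (rem w D) (size_rem wD) => [|u s _]; last by exists u; rewrite mem_head.
  by move: D1; case: (size D) => [|[]].
have {uDr} [uw uD'] : u != w /\ u \in D.
  by move: uDr; rewrite mem_rem_uniq // inE => /andP[].
(* Since [f w = v] and [w] is not in [E], [w] is no input at all, so [g] changes no input. *)
pose g x := if x == w then u else x.
exists (rename g h), u; split; first exact: dren.
  rewrite deq_countE outputs_rename count_map.
  apply: (@leq_trans (size [:: w; u])) => //.
  rewrite -size_filter uniq_leq_size //= ?inE 1?eq_sym ?uw //.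
  move=> x; rewrite !inE => /orP[] /eqP ->; rewrite mem_filter /= /g ?eqxx /=.
    by move: wD; rewrite mem_filter => /andP[].
  by rewrite (negPf uw) eqxx /=; move: uD'; rewrite mem_filter => /andP[].
rewrite enq_countE inputs_rename count_map.
rewrite (@eq_in_count _ _ (pred1 u)) ?count_uniq_mem ?leq_b1 //.
move=> x xh /=; rewrite /g; case: (x =P w) => // xw.
by move: wE wD; rewrite !mem_filter -xw xh /= andbT => /negPf->.
Qed.

(** * Changes at a single index *)

Lemma update_eq (T : Type) (p : nat -> T) t s : update p t s t = s.
Proof. by rewrite /update eqxx. Qed.

Lemma update_neq (T : Type) (p : nat -> T) t s u : u != t -> update p t s u = p u.
Proof. by rewrite /update => /negPf->. Qed.

(** Both counts split off the only occurrence of [i]; the additive form avoids subtraction. *)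
Lemma count_off1 (T : eqType) (i : T) (f g : pred T) s : uniq s ->
  (forall j, j != i -> f j = g j) ->
  count f s + (g i && (i \in s)) = count g s + (f i && (i \in s)).
Proof.
move=> us fg; have [is_|is_] := boolP (i \in s); last first.
  rewrite !andbF; congr (_ + _); apply: eq_in_count => j js; apply: fg.
  by apply: contraNneq is_ => <-.
rewrite !andbT (permP (perm_to_rem is_)) (permP (perm_to_rem is_) g) /=.
rewrite (@eq_in_count _ f g (rem i s)); first by rewrite [RHS]addnC addnA addnAC.
by move=> j; rewrite mem_rem_uniq // inE => /andP[/fg].
Qed.

Lemma prg_exec_size (V : eqType) (I : queue_impl V) (P : program V) s
    (ts : seq (thread I)) :
  prg_exec P s ts -> size P = size ts.
Proof.
by elim=> [|{}s s' ts1 th th' ts2 _ -> _]; rewrite ?size_map // !size_cat.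
Qed.

(** * From program executions to histories *)

Section ProgramToHistory.
Variables (V : eqType) (I : queue_impl V) (v : V) (m : nat).

(** Dequeues are unrestricted: dequeues of [v] are only bounded from below, so extra ones do no
    harm. *)
Fixpoint avoids (c : cmd V) : Prop :=
  match c with
  | Enq x => x != v
  | Deq _ => True
  | Choose _ b => forall a, avoids (b a)
  end.

Definition role (i : nat) (c : cmd V) : Prop :=
  if i == 0 then c = Enq v else if i <= m then c = Deq (Some v) else avoids c.

(** A [deq(v)] position never runs an enqueue, so it terminates only by returning [v]. A diverged
    thread leaves its client inside the dequeue forever. *)
Definition simulates (i : nat) (th : thread I) (cl : client I) : Prop :=
  match th with
  | Todo c => cl = Idle I /\ role i c
  | RunEnq q => cl = InEnq q /\ ~~ (0 < i <= m)
  | RunDeq o q => cl = InDeq q /\ (0 < i <= m -> o = Some v)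
  | _ => True
  end.

Definition started (th : thread I) : bool := if th is Todo _ then false else true.

Lemma role_nth_Prg k i c :
  nth (@Diverged V I) (map (@Todo V I) (Prg v 1 m k)) i = Todo I c -> role i c.
Proof.
(* Past the end of the program the default [Diverged] contradicts the premise. *)
have [ik|ik] := ltnP i (size (Prg v 1 m k)); last by rewrite nth_default ?size_map.
rewrite (nth_map (Enq v)) // => -[<-]; rewrite /role /Prg.
case: i ik => [|i] //; rewrite !size_cat !size_nseq ltnS /= => ik.
rewrite nth_cat size_nseq; case: ltnP => im; rewrite nth_nseq ?im //.
by rewrite ltn_subLR // ik /= => -[] [].
Qed.

(** An enqueue counts from its invocation, a dequeue only from its return: hence [started] for
    thread 0 and [terminated] for the [deq(v)] threads. *)
Definition advances i h (p : nat -> client I) th s' th' : Prop := exists h' p',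
  [/\ exec h' (s', p'), forall j, j != i -> p' j = p j, simulates i th' (p' i),
   enq_count v h' <= enq_count v h + [&& i == 0, started th' & ~~ started th] &
   deq_count v h + [&& 0 < i <= m, terminated th' & ~~ terminated th]
     <= deq_count v h'].

Lemma advances_update i h h' p c th s' th' :
  exec h' (s', update p i c) -> simulates i th' c ->
  enq_count v h' <= enq_count v h + [&& i == 0, started th' & ~~ started th] ->
  deq_count v h + [&& 0 < i <= m, terminated th' & ~~ terminated th]
    <= deq_count v h' ->
  advances i h p th s' th'.
Proof.
move=> Eh' sim enqs deqs; exists h', (update p i c).
by split=> //; [exact: update_neq | rewrite update_eq].
Qed.

(** Calls, method steps and matching returns are mirrored by one step of the implementation; choices
    and divergence leave its execution unchanged. *)
Lemma thread_step_advances i h p s s' th th' :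
  thread_step s th s' th' -> exec h (s, p) -> simulates i th (p i) ->
  advances i h p th s' th'.
Proof.
move=> st Eh; case: th s' th' / st =>
  [A b a|x|o|q s' q' st|o q s' q' st|q rq|o q rq|o q o' rq oo|] /=.
- rewrite {1}/role; case: (i =P 0) => [_ [] //|/eqP/negPf i0].
  case: (leqP i m) => [_ [] //|im] [pi av].
  exists h, p; rewrite !andbF !addn0; split=> //; split=> //.
  by rewrite /role i0 leqNgt im.
- move=> [pi ri]; apply: (advances_update (exec_inv_enq x Eh pi));
    rewrite ?deq_count_rcons ?enq_count_rcons ?andbF ?andbT ?addn0 //=.
    split=> //; move: ri; rewrite /role lt0n; case: eqP => // _.
    by case: leqP.
  rewrite leq_add2l; move: ri; rewrite /role; case: eqP => [_ [->]|_].
    by rewrite eqxx.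
  by case: leqP => // _ /= /negPf->.
- move=> [pi ri]; apply: (advances_update (exec_inv_deq Eh pi));
    rewrite ?deq_count_rcons ?enq_count_rcons ?andbF ?andbT ?addn0 ?leq_addr //=.
  split=> // /andP[i0 im]; move: ri; rewrite /role im.
  by case: eqP i0 => [->|_ _ [->]].
- move=> [pi ri]; apply: (advances_update (exec_enq Eh pi st));
    by rewrite ?andbF ?addn0.
- move=> [pi ri]; apply: (advances_update (exec_deq Eh pi st));
    by rewrite ?andbF ?addn0.
- move=> [pi /negPf r]; apply: (advances_update (exec_ret_enq Eh pi rq));
    by rewrite ?deq_count_rcons ?enq_count_rcons ?r ?andbF ?addn0.
- move=> [pi ri]; apply: (advances_update (exec_ret_deq Eh pi rq));
    rewrite ?deq_count_rcons ?enq_count_rcons ?andbF ?andbT ?addn0 //=.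
  by rewrite leq_add2l; case: (0 < i <= m) ri => // /(_ isT) ->; rewrite eqxx.
- by move=> _; exists h, p; rewrite !andbF !addn0.
- by move=> _; exists h, p; rewrite !andbF !addn0.
Qed.

Lemma prg_exec_induced k s ts : prg_exec (Prg v 1 m k) s ts ->
  exists h p, [/\ exec h (s, p),
    forall i, simulates i (nth (Diverged I) ts i) (p i),
    enq_count v h <= started (nth (Diverged I) ts 0) &
    count (fun i => terminated (nth (Diverged I) ts i)) (iota 1 m)
      <= deq_count v h].
Proof.
set P := Prg _ _ _ _; elim=> {s ts} [|s s' ts1 th th' ts2 _ IH st].
  exists [::], (fun=> Idle I); split=> //; first exact: exec_init.
    move=> i; have := @role_nth_Prg k i.
    have [ik|ik] := ltnP i (size P); last by rewrite nth_default ?size_map.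
    by rewrite (nth_map (Enq v)) // => /(_ _ erefl).
  rewrite (@eq_count _ _ pred0) ?count_pred0 // => i.
  have [ik|ik] := ltnP i (size P); last by rewrite nth_default ?size_map.
  by rewrite (nth_map (Enq v)).
case: IH => [h [p [Eh sim enqs deqs]]].
pose i := size ts1; set T := nth (Diverged I) _ in sim enqs deqs.
have Ti : T i = th by rewrite /T nth_cat ltnn subnn.
have Tup : nth (Diverged I) (ts1 ++ th' :: ts2) =1 update T i th'.
  move=> j; rewrite /update /T !nth_cat -/i; case: ltngtP => // ij.
    by rewrite -(subnSK ij).
  by rewrite ij subnn.
have [|h' [p' [Eh' pp' simi enqs' deqs']]] := thread_step_advances (i := i) st Eh.
  by rewrite -Ti.
exists h', p'; split=> //.
- by move=> j; rewrite Tup /update; case: eqP => [->|/eqP ji] //; rewrite pp'.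
- rewrite Tup /update eq_sym; apply: leq_trans enqs' _.
  have started_mono : started th -> started th' by case: st.
  move: enqs; case: eqP => [i0|_]; last by rewrite addn0.
  rewrite -i0 Ti /= => enqs; apply: leq_trans (leq_add enqs (leqnn _)) _.
  by case: (started th) started_mono => [->|] //; rewrite andbT.
- apply: leq_trans deqs'; rewrite (eq_count (fun j => congr1 _ (Tup j))).
  have off j : j != i -> terminated (update T i th' j) = terminated (T j).
    by move=> ji; rewrite update_neq.
  have := count_off1 (iota_uniq 1 m) off.
  rewrite /= update_eq Ti mem_iota add1n ltnS; move: deqs.
  case: (0 < i <= m); rewrite ?andbF ?addn0 /= => deqs; last by move=> ->.
  rewrite !andbT => count_eq; rewrite -(leq_add2r (terminated th)) count_eq.
  by rewrite -addnA leq_add //; case: (terminated th) (terminated th') => [] [].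
Qed.

End ProgramToHistory.

(** * From histories to program executions *)

Section HistoryToProgram.
Variables (V : eqType) (I : queue_impl V).
Implicit Types (s : shared I) (h : history V) (v : V).

(** Events are numbered by invocation order. Running ones record the calling thread of the history;
    finished ones do not, since that thread may be in another call. *)
Inductive event : Type :=
| Fresh
| RunningEnq of nat & V & pc (enq I)
| RunningDeq of nat & pc (deq I)
| DoneEnq of V
| DoneDeq of option V.

Implicit Types (e : nat -> event).

Definition enqueues v (r : event) : bool :=
  match r with RunningEnq _ x _ | DoneEnq x => x == v | _ => false end.

Definition dequeued v (r : event) : bool :=
  if r is DoneDeq o then o == Some v else false.

(** Fresh and finished events count as owned by every thread: replacing them disturbs no running
    call. *)
Definition owned_by (t : nat) (r : event) : bool :=
  match r with RunningEnq u _ _ | RunningDeq u _ => u == t | _ => true end.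

(* A running dequeue is realized by [Deq o] for every [o]: the thread that
   performs it in the program need not be known before it returns. *)
Inductive realizes : event -> cmd V -> thread I -> Prop :=
| realizes_fresh c : realizes Fresh c (Todo I c)
| realizes_running_enq t x q : realizes (RunningEnq t x q) (Enq x) (RunEnq q)
| realizes_running_deq t q o : realizes (RunningDeq t q) (Deq o) (RunDeq o q)
| realizes_done_enq x : realizes (DoneEnq x) (Enq x) (Terminated I)
| realizes_done_deq o : realizes (DoneDeq o) (Deq o) (Terminated I).

(** Quantifying over all compatible commands postpones their choice. Fresh indices in [sigma] are
    unstarted threads, ready for later invocations. *)
Definition realizable s e : Prop := forall C T (sigma : seq nat),
  (forall i, realizes (e i) (C i) (T i)) -> uniq sigma ->
  (forall i, e i <> Fresh -> i \in sigma) ->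
  prg_exec (map C sigma) s (map T sigma).

Lemma realizable_update s s' e i r : realizable s e -> r <> Fresh ->
  (forall c th', realizes r c th' ->
     exists2 th, realizes (e i) c th & thread_step s th s' th') ->
  realizable s' (update e i r).
Proof.
move=> re rF rstep C T sigma eCT us cov.
have is_ : i \in sigma by apply: cov; rewrite update_eq.
have := eCT i; rewrite update_eq => /rstep[th ei st].
(* The same commands are run up to the state [th] of thread [i] just before the step. *)
have {re} := re C (update T i th) sigma _ us _.
case/splitPr: is_ us {cov} (cov) => l1 l2; rewrite uniq_catC cons_uniq mem_cat.
case/andP => /norP[il2 il1] _ cov.
rewrite !map_cat !map_cons update_eq.
have same l : i \notin l -> map (update T i th) l = map T l.
  move=> il; apply/eq_in_map => j jl; rewrite update_neq //.
  by apply: contraNneq il => <-.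
rewrite !same // => pe; apply: prg_step st; apply: pe => j.
  by rewrite /update; case: eqP (eCT j) => [->|/eqP ji] //; rewrite update_neq.
move=> ej; apply: cov; rewrite /update; by case: eqP.
Qed.

Definition live e (t : nat) (c : client I) : Prop :=
  match c with
  | Idle => True
  | InEnq q => exists i x, e i = RunningEnq t x q
  | InDeq q => exists i, e i = RunningDeq t q
  end.

Definition tracks h (g : config I) (n : nat) e : Prop :=
  [/\ realizable g.1 e, forall i, n <= i -> e i = Fresh,
      forall t, live e t (g.2 t),
      forall v, count (enqueues v \o e) (iota 0 n) = enq_count v h &
      forall v, count (dequeued v \o e) (iota 0 n) = deq_count v h].

Lemma tracks_widen h g n e : tracks h g n e -> tracks h g n.+1 e.
Proof.
case=> re fr lv en de; have en0 := fr n (leqnn n); split=> //.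
- by move=> i /ltnW; apply: fr.
- by move=> v; rewrite -addn1 iotaD count_cat en /= en0 !addn0.
- by move=> v; rewrite -addn1 iotaD count_cat de /= en0 !addn0.
Qed.

Lemma tracks_update h h' s s' p n e i r t c :
  tracks h (s, p) n e -> i < n -> r <> Fresh -> owned_by t (e i) ->
  (forall c th', realizes r c th' ->
     exists2 th, realizes (e i) c th & thread_step s th s' th') ->
  (c = Idle I \/ live (fun=> r) t c) ->
  (forall v, enq_count v h' + enqueues v (e i) = enq_count v h + enqueues v r) ->
  (forall v, deq_count v h' + dequeued v (e i) = deq_count v h + dequeued v r) ->
  tracks h' (s', update p t c) n (update e i r).
Proof.
move=> [re fr lv en de] i_n rF own rstep cr en' de'.
have off (f : pred event) : count (f \o update e i r) (iota 0 n) + f (e i) =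
    count (f \o e) (iota 0 n) + f r.
  have := @count_off1 _ i (f \o update e i r) (f \o e) _ (iota_uniq 0 n).
  rewrite /= update_eq mem_iota /= i_n !andbT; apply=> j ji.
  by rewrite update_neq.
split=> /=.
- exact: realizable_update rstep.
- by move=> j nj; rewrite update_neq ?fr //; apply: contraTneq nj => ->;
    rewrite -ltnNge.
- move=> u; rewrite /(update p); case: eqP => [->|/eqP ut].
    case: c cr => [|q|q] [] //= [_].
      by case=> x ->; exists i, x; rewrite update_eq.
    by move=> ->; exists i; rewrite update_eq.
  move: (lv u) => /=; case: (p u) => [|q|q] //=.
    move=> [j [x ej]]; exists j, x; rewrite update_neq //.
    by apply: contraNneq ut => ji; move: own; rewrite -ji ej.
  move=> [j ej]; exists j; rewrite update_neq //.
  by apply: contraNneq ut => ji; move: own; rewrite -ji ej.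
- by move=> v; apply: (@addIn (enqueues v (e i))); rewrite off en en'.
- by move=> v; apply: (@addIn (dequeued v (e i))); rewrite off de de'.
Qed.

(** An invocation takes the fresh index [n]; a step or return acts on the running event that [live]
    provides. *)
Lemma exec_tracked h g : exec h g -> exists n e, tracks h g n e.
Proof.
elim=> {h g}.
- exists 0, (fun=> Fresh); split=> //= C T sigma eCT _ _.
  rewrite (@eq_map _ _ T (@Todo V I \o C)).
    by rewrite map_comp; apply: prg_init.
  by move=> i; have H := eCT i; inversion H.
- move=> h s p t x _ [n [e tr]] pt; have [_ fr _ _ _] := tr.
  have en : e n = Fresh := fr n (leqnn n).
  exists n.+1, (update e n (RunningEnq t x (start (enq I) x))).
  apply: tracks_update (tracks_widen tr) _ _ _ _ _ _ _; rewrite ?en //=.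
  + move=> c th' H; inversion H; exists (Todo I (Enq x)); constructor.
  + by right; exists 0, x.
  + by move=> v; rewrite enq_count_rcons addn0.
  + by move=> v; rewrite deq_count_rcons addn0.
- move=> h s p t _ [n [e tr]] pt; have [_ fr _ _ _] := tr.
  have en : e n = Fresh := fr n (leqnn n).
  exists n.+1, (update e n (RunningDeq t (start (deq I) tt))).
  apply: tracks_update (tracks_widen tr) _ _ _ _ _ _ _; rewrite ?en //=.
  (* Here [o] is arbitrary: the call does not fix the value to be returned. *)
  + move=> c th' H; inversion H; exists (Todo I (Deq o)); constructor.
  + by right; exists 0.
  + by move=> v; rewrite enq_count_rcons addn0.
  + by move=> v; rewrite deq_count_rcons addn0.
- move=> h s p t q s' q' _ [n [e tr]] pt st; have [_ fr lv _ _] := tr.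
  have := lv t; rewrite /= pt => -[i [x ei]].
  exists n, (update e i (RunningEnq t x q')).
  apply: tracks_update tr _ _ _ _ _ _ _; rewrite ?ei //=.
  + by rewrite ltnNge; apply/negP => /fr; rewrite ei.
  + by move=> c th' H; inversion H; exists (RunEnq q); constructor.
  + by right; exists 0, x.
- move=> h s p t q s' q' _ [n [e tr]] pt st; have [_ fr lv _ _] := tr.
  have := lv t; rewrite /= pt => -[i ei].
  exists n, (update e i (RunningDeq t q')).
  apply: tracks_update tr _ _ _ _ _ _ _; rewrite ?ei //=.
  + by rewrite ltnNge; apply/negP => /fr; rewrite ei.
  + by move=> c th' H; inversion H; exists (RunDeq o q); constructor.
  + by right; exists 0.
- move=> h s p t q _ [n [e tr]] pt rq; have [_ fr lv _ _] := tr.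
  have := lv t; rewrite /= pt => -[i [x ei]].
  exists n, (update e i (DoneEnq x)).
  apply: tracks_update tr _ _ _ _ _ _ _; rewrite ?ei //=.
  + by rewrite ltnNge; apply/negP => /fr; rewrite ei.
  + by move=> c th' H; inversion H; exists (RunEnq q); constructor.
  + by left.
  + by move=> v; rewrite enq_count_rcons addn0.
  + by move=> v; rewrite deq_count_rcons addn0.
- move=> h s p t q o _ [n [e tr]] pt rq; have [_ fr lv _ _] := tr.
  have := lv t; rewrite /= pt => -[i ei].
  exists n, (update e i (DoneDeq o)).
  apply: tracks_update tr _ _ _ _ _ _ _; rewrite ?ei //=.
  + by rewrite ltnNge; apply/negP => /fr; rewrite ei.
  (* Only the return fixes the command of the thread to be [Deq o]. *)
  + by move=> c th' H; inversion H; exists (RunDeq o q); constructor.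
  + by left.
  + by move=> v; rewrite enq_count_rcons addn0.
  + by move=> v; rewrite deq_count_rcons addn0.
Qed.

(** * Resolving the choices and assigning events to program threads *)

Definition chosen v (c : cmd V) : bool :=
  match c with Enq x => x != v | Deq o => o != Some v | Choose _ _ => false end.

Lemma prg_exec_trans (P Q : program V) s ts :
  prg_exec P (init I) (map (@Todo V I) Q) -> prg_exec Q s ts -> prg_exec P s ts.
Proof. by move=> PQ; elim=> // {}s s' ts1 th th' ts2 _ PE; apply: prg_step. Qed.

(** Each copy of [other v] takes two choice steps, which keep the shared state initial; [pre]
    collects the resolved threads. *)
Lemma prg_exec_chosen v (P pre cs : program V) : all (chosen v) cs ->
  prg_exec P (init I) (map (@Todo V I) (pre ++ nseq (size cs) (other v))) ->
  prg_exec P (init I) (map (@Todo V I) (pre ++ cs)).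
Proof.
elim: cs pre => //= c cs IH pre /andP[cv csv] PE.
rewrite -cat_rcons; apply: IH => //.
rewrite cat_rcons; move: PE; rewrite !map_cat /= => PE.
case: c cv => [x xv|o ov|//].
  have st := step_choice (init I) (fun x : {x | x != v} => Enq (val x))
    (exist _ x xv).
  by apply: prg_step st; apply: prg_step PE (step_choice _ _ true).
have st := step_choice (init I) (fun o : {o | o != Some v} => Deq (val o))
  (exist _ o ov).
by apply: prg_step st; apply: prg_step PE (step_choice _ _ false).
Qed.

(** A dequeue still running gets [Deq None]: NULL is never [Some v], so a copy of [other v] can
    perform it. *)
Definition event_cmd (r : event) : cmd V :=
  match r with
  | RunningEnq _ x _ | DoneEnq x => Enq x
  | DoneDeq o => Deq o
  | _ => Deq None
  end.

Definition event_thread (c : cmd V) (r : event) : thread I :=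
  match r with
  | Fresh => Todo I c
  | RunningEnq _ _ q => RunEnq q
  | RunningDeq _ q => RunDeq None q
  | _ => Terminated I
  end.

(** With one [deq(v)] thread per completed dequeue of [v], all of them terminate. *)
Lemma exec_prg_exec h g v : exec h g -> enq_count v h <= 1 ->
  exists k (ts : seq (thread I)),
  prg_exec (Prg v 1 (deq_count v h) k) g.1 ts /\
  deq_terminated 1 (deq_count v h) ts = deq_count v h.
Proof.
move=> /exec_tracked[n [e [re fr _ en de]]] enq1.
(* The spare index [n] is fresh; it supplies the unstarted [enq(v)] thread when [v] is never
   enqueued. *)
pose C i := if (i == n) && (enq_count v h == 0) then Enq v else event_cmd (e i).
pose T i := event_thread (C i) (e i).
pose isE i := if C i is Enq x then x == v else false.
pose isD i := if C i is Deq o then o == Some v else false.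
have en0 : e n = Fresh := fr n (leqnn n).
(* [E], [D] and [O] collect the indices for [enq(v)], [deq(v)] and the copies of [other v]. *)
set l := iota 0 n.+1; pose E := filter isE l; pose R := filter (predC isE) l.
pose D := filter isD R; pose O := filter (predC isD) R.
have sizeE : size E = 1.
  rewrite size_filter /l -addn1 iotaD count_cat /=.
  rewrite (@eq_in_count _ isE (enqueues v \o e)); last first.
    move=> i; rewrite mem_iota add0n /= /isE /C => i_n.
    by rewrite ltn_eqF //=; case: (e i).
  rewrite en addn0 add0n /isE /C eqxx en0.
  by case: (enq_count v h) enq1 => [|[]] //=; rewrite eqxx.
have sizeD : size D = deq_count v h.
  rewrite size_filter count_filter -de /l -addn1 iotaD count_cat /= add0n.
  rewrite {2}/isD {2}/isE /C eqxx en0.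
  rewrite (_ : (_ && _) = false :> bool) ?addn0; last by case: (_ == 0).
  apply: eq_in_count => i; rewrite mem_iota add0n /= /isE /isD /C => i_n.
  by rewrite ltn_eqF //=; case: (e i) => //= *; rewrite ?andbT ?andbF.
exists (size O), (map T (E ++ D ++ O)).
have permEDO : perm_eq (E ++ D ++ O) l.
  by rewrite perm_sym -(perm_filterC isE l) perm_cat2l perm_sym perm_filterC.
have PE : prg_exec (map C (E ++ D ++ O)) g.1 (map T (E ++ D ++ O)).
  apply: re; first by move=> i; rewrite /T /C; case: (i =P n) => [->|_] /=;
    [rewrite en0|case: (e i)]; constructor.
    by rewrite (perm_uniq permEDO) iota_uniq.
  move=> i ei; rewrite (perm_mem permEDO) mem_iota add0n ltnS /=.
  by rewrite leqNgt; apply/negP => /ltnW /fr.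
have CE : map C E = [:: Enq v].
  have -> : map C E = map (fun=> Enq v) E.
    apply/eq_in_map => i; rewrite mem_filter /isE => /andP[] Ci _.
    by case: (C i) Ci => // x /eqP->.
  by move: sizeE; case: (E) => [|i []].
have CD : map C D = nseq (deq_count v h) (Deq (Some v)).
  have -> : map C D = map (fun=> Deq (Some v)) D.
    apply/eq_in_map => i; rewrite mem_filter /isD => /andP[] Ci _.
    by case: (C i) Ci => // o /eqP->.
  by rewrite -sizeD; elim: (D) => //= i l' ->.
split.
  (* All choices are resolved before any method is called. *)
  apply: prg_exec_trans PE.
  rewrite !(map_cat C) CE CD catA /Prg -[size O](size_map C) catA.
  apply: prg_exec_chosen; last exact: prg_init.
  rewrite all_map; apply/allP => i; rewrite !mem_filter /= => /and3P[].
  rewrite /isD /isE /C; case: ifP => _; first by rewrite /= eqxx.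
  by case: (e i).
rewrite /deq_terminated map_cat drop_size_cat ?size_map ?sizeE //.
rewrite map_cat take_size_cat ?size_map ?sizeD // -sizeD -(size_map T D).
(* Only finished dequeues are assigned [Deq (Some v)]. *)
apply/eqP; rewrite -all_count all_map; apply/allP => i.
rewrite !mem_filter /= /isD /T /C => /and3P[]; case: ifP => // _.
by case: (e i).
Qed.
End HistoryToProgram.

Theorem theorem6p2 (V : eqType) (I : queue_impl V)
    (hdata : data_independent I) (hcompl : completable I) :
  ~ VRepet_violation I <->
  (forall (v : V) (m k : nat), 1 < m ->
     ~ exists (s : shared I) (ts : seq (thread I)),
         prg_exec (Prg v 1 m k) s ts /\ 1 < deq_terminated 1 m ts).
Proof.
split=> [noviol v m k m1 [s [ts [PE deq1]]]|noexec /VRepet_violation_differentiated].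
  have [h [p [Eh _ enqs deqs]]] := prg_exec_induced PE.
  have deqts : deq_terminated 1 m ts <= deq_count v h.
    apply: leq_trans deqs; rewrite /deq_terminated -(count_map (nth _ ts)).
    (* The program has [1 + m + k] threads, so positions 1 to [m] all exist. *)
    rewrite map_nth_iota // -(prg_exec_size PE) /= size_cat size_nseq subn1.
    exact: leq_addr.
  apply: noviol; exists h, v; split; first by exists (s, p).
    exact: leq_trans deqts.
  apply: leq_ltn_trans (leq_trans deq1 deqts).
  exact: leq_trans enqs (leq_b1 _).
move=> /(_ hdata) [h [v [[g Eh] deq1 enq1]]].
have [k [ts [PE deqE]]] := exec_prg_exec Eh enq1.
by apply: (noexec v _ k deq1); exists g.1, ts; rewrite deqE.
Qed.
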